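(* Let $K$ be a field of characteristic different from $2$, let $k=2\ell$ be any non-negative even integer, and let $h\in\mathbb{N}$ (a positive integer). Then $$S^k(h\times\mathbb{H})=S^{2\ell}(h\times\mathbb{H})\simeq\binom{h+\ell-1}{\ell}\times\langle 1\rangle\perp\frac{1}{2}\left(\binom{2h+2\ell-1}{2\ell}-\binom{h+\ell-1}{\ell}\right)\times\mathbb{H}.$$
   Context: $K$ is a field with $\mathrm{char}(K)\neq 2$, and symmetric bilinear forms over $K$ are identified with quadratic forms. $\langle a_1,\dots,a_m\rangle$ denotes the diagonal form with coefficients $a_i\in K^{\times}$. $\mathbb{H}=\langle 1,-1\rangle$ is the hyperbolic plane. For $r\ge 0$, $r\times\varphi$ denotes the orthogonal sum of $r$ copies of $\varphi$. $\perp$ denotes orthogonal sum and $\simeq$ denotes isometry. (Non-factorial) symmetric power: for $\varphi\simeq\langle a_1,\dots,a_m\rangle$ and an integer $k\ge 0$, the $k$-fold symmetric power $S^k\varphi$ is the diagonal form on the $k$-th symmetric power $S^kV$ of the underlying space $V$ given by the orthogonal sum of the one-dimensional forms $\langle a_{i_1}^{k_{i_1}}\cdots a_{i_\ell}^{k_{i_\ell}}\rangle$ over all choices of indices $1\le i_1<\dots<i_\ell\le m$ and positive integers $k_{i_1},\dots,k_{i_\ell}$ with $k_{i_1}+\dots+k_{i_\ell}=k$. That is, there is one summand for each degree-$k$ monomial in $a_1,\dots,a_m$. In particular $S^0\varphi=\langle 1\rangle$, $S^1\varphi=\varphi$ and $\dim S^k\varphi=\binom{m+k-1}{k}$. Up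 to isometry $S^k\varphi$ depends only on the isometry class of $\varphi$. *)

(* Defs.v *)
From mathcomp Require Import all_boot all_order all_algebra.

Set Implicit Arguments.
Unset Strict Implicit.
Unset Printing Implicit Defensive.

Import GRing.Theory.
Local Open Scope ring_scope.

(* A diagonal form <a_1, ..., a_m> is given by the sequence of its
   coefficients. Orthogonal sum of diagonal forms is then concatenation
   of sequences, and the zero form is the empty sequence. *)

Section DiagonalForms.
Variable K : fieldType.
Implicit Types (a b : seq K) (r k : nat).

Definition dmx a : 'M[K]_(size a) := diag_mx (\row_i a`_i).

Lemma dmx_symmetric a : dmx a \is hermitianmx (size a) false idfun.
Proof. by rewrite qualifE /= expr0 scale1r map_mx_id // tr_diag_mx. Qed.

Definition dform a : {symmetric 'rV[K]_(size a)} :=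
  form_of_matrix idfun (HermitianMx (dmx_symmetric a)).

Lemma dformE a (u v : 'rV[K]_(size a)) :
  dform a u v = \sum_(i < size a) a`_i * u 0 i * v 0 i.
Proof.
rewrite /dform /= /form_of_matrix /= trace_mx11 map_mx_id // mxE.
by apply: eq_bigr => i _; rewrite mul_mx_diag !mxE [u 0 i * _]mulrC.
Qed.

Definition hyperbolic : seq K := [:: 1; -1].

Definition copies r a : seq K := flatten (nseq r a).

(* One coefficient for each monomial of degree k in size a variables: a
   monomial is given by its exponent vector e, and the indices with exponent 0
   contribute a factor 1. This is the symmetric power computed on a given
   diagonalization; its isometry class does not depend on that choice. *)
Definition sympow k a : seq K :=
  [seq \prod_(i < size a) a`_i ^+ tnth e i
     | e : (size a).-tuple 'I_k.+1 in
         [set e : (size a).-tuple 'I_k.+1 | \sum_(j <- e) j == k]%N].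

Lemma size_sympow k a :
  (0 < size a)%N -> size (sympow k a) = 'C(size a + k - 1, k).
Proof.
case: a => // x a _; rewrite /sympow size_image /= card_ord_partitions.
by rewrite addSn subn1 /= -[in RHS]bin_sub ?leq_addl // addnK.
Qed.

End DiagonalForms.

Definition isometric (K : fieldType) (U V : lmodType K)
    (f : {symmetric U}) (g : {symmetric V}) : Prop :=
  exists2 tau : {linear U -> V}, bijective tau & isometry g f tau.

Arguments hyperbolic : clear implicits.

Declare Scope qform_scope.
Delimit Scope qform_scope with qf.
Notation "a ⟂ b" := (a ++ b) (at level 60, right associativity) : qform_scope.
Notation "r × a" := (copies r a) (at level 40, no associativity) : qform_scope.
Notation "a ≃ b" := (isometric (dform a) (dform b))
  (at level 70, no associativity) : qform_scope.

(* Main.v *)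
Require Import Defs.
From mathcomp Require Import all_boot all_order all_algebra.
From mathcomp Require Import perm ring zify.

Set Implicit Arguments.
Unset Strict Implicit.
Unset Printing Implicit Defensive.

(** Every coefficient of [h × hyperbolic K] is [1] or [-1], hence so is every
    coefficient of its symmetric power. A diagonal form does not change, up to
    isometry, when its coefficients are permuted ([perm_isometric]), so the
    result is purely a count of signs. A sequence of signs is determined up to
    order by its length and its sum: if the sum is [c >= 0], then cancelling
    each minus sign against a plus sign leaves [c] plus signs and
    [(length - c) / 2] hyperbolic planes ([perm_eq_signs]).

    The length is the number of monomials of degree [2l] in [2h] variables. The
    sum is the value of the complete homogeneous symmetric polynomial of degree
    [2l] at [h] ones and [h] minus ones, that is, the coefficient of [X^(2l)] in
    [(1 - X)^-h (1 + X)^-h = (1 - X^2)^-h], which is ['C(h + l - 1, l)]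
    ([sum_monomials], [signed_sum_hyperbolic]).

    The signs are kept as booleans, with [true] for [-1], and added up in [int]:
    the sum of their images in [K] would lose information in positive
    characteristic. The geometric series are truncated at a degree [N >= 2l],
    which changes no coefficient that matters. *)

Import GRing.Theory.

Local Open Scope ring_scope.
Local Open Scope qform_scope.

(** A permutation matching the coefficients also permutes the coordinates, and
    this coordinate change is the isometry. *)
Lemma perm_isometric (K : fieldType) (a b : seq K) : perm_eq a b -> a ≃ b.
Proof.
move=> pab; have Eab := perm_size pab.
have /(@tuple_permP _ _ _ (in_tuple b))[p Ea] := pab.
pose q (j : 'I_(size b)) : 'I_(size a) := cast_ord (esym Eab) ((p^-1)%g j).
pose q' (i : 'I_(size a)) : 'I_(size b) := p (cast_ord Eab i).
have qK : cancel q q' by move=> j; rewrite /q' cast_ordKV permKV.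
have q'K : cancel q' q by move=> i; rewrite /q permK cast_ordK.
have b_q (j : 'I_(size b)) : b`_j = a`_(q j).
  transitivity (a`_((p^-1)%g j)) => //.
  by rewrite [in RHS]Ea nth_mktuple permKV (tnth_nth 0).
exists (colsub q : {linear 'rV[K]_(size a) -> 'rV[K]_(size b)}).
  by exists (colsub q') => u; apply/matrixP=> i j; rewrite !mxE ?qK ?q'K.
move=> u v; rewrite !dformE [RHS](reindex q) /=; last first.
  by apply: onW_bij; exists q'.
by apply: eq_bigr => j _; rewrite !mxE b_q.
Qed.

(** There are [c] more plus signs than minus signs. In particular the
    subtraction does not truncate and the division is exact, its value being
    the number of minus signs. *)
Lemma perm_eq_signs (s : seq bool) (c : nat) :
    \sum_(b <- s) (-1) ^+ b = c%:R :> int ->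
  perm_eq s (nseq c false ++ flatten (nseq ((size s - c) %/ 2) [:: false; true])).
Proof.
move=> sum_s.
have Ec : count_mem false s = (c + count_mem true s)%N.
  suff: (count_mem false s)%:Z = c%:Z + (count_mem true s)%:Z by lia.
  have -> : c%:Z = c%:R :> int by rewrite natz.
  rewrite -sum_s; elim: s {sum_s} => [|[] s IHs]; rewrite ?big_nil ?big_cons //=;
    by rewrite !PoszD IHs ?expr0 ?expr1; ring.
have Es : size s = (count_mem false s + count_mem true s)%N.
  elim: s {sum_s Ec} => //= -[] s /= IHs;
  by rewrite ?add0n ?add1n ?addnS ?addSn; congr _.+1.
have -> : ((size s - c) %/ 2)%N = count_mem true s by lia.
apply/allP => b _ /=; apply/eqP.
rewrite count_cat count_nseq count_flatten map_nseq sumn_nseq.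
by case: b; rewrite /= ?Ec ?mul0n ?mul1n ?addn0 ?add0n ?mul1n.
Qed.

(** Generating function of the complete homogeneous symmetric polynomials.
    Exponents are bounded by the degree [k] itself, so truncating each
    geometric series after [X^k] leaves the coefficient of [X^k] intact. *)
Lemma sum_monomials (R : comNzRingType) n k (x : 'I_n -> R) :
  \sum_(e : n.-tuple 'I_k.+1 | (\sum_(j <- e) j == k)%N)
     \prod_i x i ^+ tnth e i
  = (\prod_i \poly_(j < k.+1) x i ^+ j)`_k.
Proof.
under [in RHS]eq_bigr do rewrite poly_def.
rewrite bigA_distr_bigA coef_sum /= big_mkcond /=.
rewrite [RHS](reindex (@finfun_of_tuple _ _)) /=; last first.
  apply: onW_bij; exists (@tuple_of_finfun _ _).
    exact: finfun_of_tupleK.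
  exact: tuple_of_finfunK.
apply: eq_bigr => e _.
rewrite scaler_prod -expr_sum coefZ coefXn eq_sym.
have -> : (\sum_i finfun_of_tuple e i)%N = (\sum_(j <- e) j)%N.
  by rewrite [RHS]big_tuple; apply: eq_bigr => i _; rewrite ffunE.
under [in RHS]eq_bigr do rewrite ffunE.
by case: eqP; rewrite ?mulr1 ?mulr0.
Qed.

(** The sign of a monomial is the parity of the total exponent of the variables
    specialised to [-1]. This parity makes no reference to [K], so the same
    signs [s] can be summed in [int]. *)
Lemma sympow_signs (K : fieldType) k (t : seq bool) :
  exists2 s : seq bool,
    sympow k [seq (-1) ^+ b | b : bool <- t] = [seq (-1) ^+ b | b : bool <- s] :> seq K
  & \sum_(b <- s) (-1) ^+ b
    = (\prod_(b <- t) \poly_(j < k.+1) ((-1) ^+ (b : bool)) ^+ j)`_k :> int.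
Proof.
rewrite /sympow; set a := map _ t; set n := size a.
have nE : n = size t by rewrite /n size_map.
pose m (e : n.-tuple 'I_k.+1) := (\sum_(i < n) nth false t i * tnth e i)%N.
have mE (R : comNzRingType) (e : n.-tuple 'I_k.+1) :
    \prod_(i < n) ((-1) ^+ nth false t i) ^+ tnth e i = (-1) ^+ odd (m e) :> R.
  rewrite signr_odd /m expr_sum.
  by apply: eq_bigr => i _; rewrite exprM.
exists [seq odd (m e) | e in [set e : n.-tuple 'I_k.+1 | \sum_(j <- e) j == k]%N].
  rewrite -map_comp; apply: eq_map => e /=; rewrite -mE.
  by apply: eq_bigr => i _; rewrite (nth_map false) // -nE.
rewrite big_map big_enum /=.
under eq_bigl do rewrite inE.
under eq_bigr do rewrite -mE.
by rewrite sum_monomials (big_nth false) big_mkord -nE.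
Qed.

Lemma geometric_poly (R : comNzRingType) N (x : R) :
  (1 - x *: 'X) * \poly_(j < N) x ^+ j = 1 - x ^+ N *: 'X^N.
Proof.
rewrite -exprZn -[RHS]opprB subrX1 -mulNr opprB poly_def; congr (_ * _).
by apply: eq_bigr => j _; rewrite exprZn.
Qed.

(** With [T] the product of the two truncated series of a hyperbolic plane,
    [T (1 - X^2)] is [1] up to degree [N]. Comparing coefficients in
    [T^(h+1) (1 - X^2)] and [T^h] yields the recursion of Pascal's triangle
    for the coefficients of even degree. *)
Lemma signed_sum_hyperbolic N h l : (2 * l <= N)%N ->
  (\prod_(b <- flatten (nseq h [:: false; true]))
      \poly_(j < N.+1) ((-1) ^+ (b : bool)) ^+ j)`_(2 * l)
  = 'C(h + l - 1, l)%:R :> int.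
Proof.
pose G (b : bool) : {poly int} := \poly_(j < N.+1) ((-1) ^+ b) ^+ j.
have -> : \prod_(b <- flatten (nseq h [:: false; true])) G b
          = (G false * G true) ^+ h.
  rewrite big_flatten /= big_nseq -[RHS]mulr1 -iter_mulr.
  by apply: eq_iter => ?; rewrite big_cons big_seq1.
set T := G false * G true.
have [Q TE] : exists Q : {poly int}, T * (1 - 'X^2) = 1 - Q * 'X^(N.+1).
  have E0 := geometric_poly N.+1 (1 : int).
  have E1 := geometric_poly N.+1 (-1 : int).
  exists (1 + (-1) ^+ N.+1 *: (1 - 'X^(N.+1))).
  transitivity ((1 - 1 *: 'X) * G false * ((1 - -1 *: 'X) * G true)).
    by rewrite /T scale1r scaleN1r; ring.
  by rewrite /G expr0 expr1 E0 E1 expr1n -!mul_polyC; ring.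
have rec i k : (k <= N)%N ->
    (T ^+ i.+1)`_k = (T ^+ i)`_k + (if (k < 2)%N then 0 else (T ^+ i.+1)`_(k - 2)).
  move=> leN; have: (T ^+ i.+1 * (1 - 'X^2))`_k = (T ^+ i)`_k.
    rewrite exprSr -mulrA TE mulrBr mulr1 mulrA coefB coefMXn ltnS leN.
    by rewrite subr0.
  by rewrite mulrBr mulr1 coefB coefMXn => <-; rewrite subrK.
elim: l h => [|l IHl] h leN.
  elim: h => [|h IHh]; first by rewrite expr0 coef1.
  by rewrite rec // IHh addr0 !bin0.
elim: h => [|h IHh].
  by rewrite expr0 coef1 add0n subn1 bin_small.
rewrite rec // IHh.
have -> : (2 * l.+1 - 2 = 2 * l)%N by lia.
have -> : (2 * l.+1 < 2)%N = false by lia.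
rewrite IHl; last by lia.
rewrite !addSn !addnS !subn1 /= binS natrD //.
Qed.

Theorem proposition3p5 (K : fieldType) (char_neq2 : 2%N \notin [pchar K])
    (l h : nat) (h_gt0 : (0 < h)%N) :
  sympow (2 * l) (h × hyperbolic K)
  ≃ 'C(h + l - 1, l) × [:: 1]
    ⟂ (('C(2 * h + 2 * l - 1, 2 * l) - 'C(h + l - 1, l)) %/ 2)%N × hyperbolic K.
Proof.
pose sgn (b : bool) : K := (-1) ^+ b.
have hypE r : r × hyperbolic K = map sgn (flatten (nseq r [:: false; true])).
  by rewrite map_flatten map_nseq.
have oneE r : r × [:: 1] = map sgn (nseq r false).
  by rewrite map_nseq; elim: r => //= r IHr; rewrite /copies /= -IHr.
have size_hyp : size (h × hyperbolic K) = (2 * h)%N.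
  by rewrite hypE size_map size_flatten /shape map_nseq sumn_nseq.
have size_s : size (sympow (2 * l) (h × hyperbolic K))
              = 'C(2 * h + 2 * l - 1, 2 * l).
  by rewrite size_sympow size_hyp //; lia.
apply: perm_isometric; move: size_s; rewrite !hypE oneE -map_cat.
have [s -> sum_s] := sympow_signs K (2 * l) (flatten (nseq h [:: false; true])).
rewrite size_map => <-; apply/perm_map/perm_eq_signs.
by rewrite sum_s signed_sum_hyperbolic.
Qed.
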